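(* Let $G = \langle X,Y,E\rangle$ be a finite, node-weighted, edge-capacitated bipartite graph, with positive node weights $v\mapsto |v|$ summing to the same value on each bipart (that is, $\sum_{x\in X}|x| = \sum_{y\in Y}|y|$) and edge capacities $e \mapsto c(e)$. Then $G$ has a full nowhere-zero flow if and only if $G$ is expansive (in the capacitated sense).
   Context: For an edge $e$ joining $x\in X$ and $y \in Y$ write $c(x,y)=c(e)$ (and $c(x,y)=0$ if there is no such edge). A full nowhere-zero flow on $G$ is an assignment of positive weights $\phi(e)$ to the edges, with $\phi(e)\le c(e)$ for every edge $e$, such that for every node $v\in X\cup Y$ the sum of $\phi(e)$ over the edges $e$ incident to $v$ equals $|v|$. For $U\subseteq X$, let $|U| := \sum_{x\in U}|x|$, and let $N(U)\subseteq Y$ be the set of nodes adjacent to at least one node of $U$. For $y\in Y$ put $|y|_U := \min\left(|y|, \sum_{x\in U}c(x,y)\right)$, and put $|N(U)|_U := \sum_{y\in N(U)}|y|_U$. A set $U\subseteq X$ is expansive (in the capacitated sense) if either $|N(U)|_U>|U|$, or $|N(U)|_U=|U|$ and no edge connects $X\setminus U$ to a node $y\in N(U)$ unless $|y|_U<|y|$. The graph $G$ is expansive if every $U\subseteq X$ is expansive.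
   Formalization: The edge capacities c(e) are assumed to be positive on every edge, like the node weights; with an edge of capacity 0 the graph can be expansive while no nowhere-zero flow exists. *)

(* Defs.v *)
From HB Require Import structures.
From mathcomp Require Import all_boot all_order all_algebra.

Set Implicit Arguments.
Unset Strict Implicit.
Unset Printing Implicit Defensive.

Import Order.TTheory GRing.Theory Num.Theory.
Local Open Scope ring_scope.

(* The values of [ecap] outside [edges] are irrelevant: the capacity function
   used everywhere is [cap] below, which is 0 on non-edges. *)
Record bigraph (R : realFieldType) (X Y : finType) := Bigraph {
  edges : {set X * Y};
  wX : X -> R;
  wY : Y -> R;
  ecap : X * Y -> R
}.

Section Defs.
Variables (R : realFieldType) (X Y : finType) (G : bigraph R X Y).

Definition cap (x : X) (y : Y) : R :=
  if (x, y) \in edges G then ecap G (x, y) else 0.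

(* Only the values of [phi] on [edges G] matter. *)
Definition full_nz_flow (phi : X * Y -> R) : Prop :=
  [/\ forall e, e \in edges G -> 0 < phi e <= ecap G e,
      forall x, \sum_(e in edges G | e.1 == x) phi e = wX G x
    & forall y, \sum_(e in edges G | e.2 == y) phi e = wY G y].

Definition has_full_nz_flow : Prop := exists phi, full_nz_flow phi.

(* |U| *)
Definition weight (U : {set X}) : R := \sum_(x in U) wX G x.

(* N(U) *)
Definition nbh (U : {set X}) : {set Y} :=
  [set y | [exists x in U, (x, y) \in edges G]].

(* |y|_U *)
Definition cweight (U : {set X}) (y : Y) : R :=
  Num.min (wY G y) (\sum_(x in U) cap x y).

(* |N(U)|_U *)
Definition nbh_cweight (U : {set X}) : R := \sum_(y in nbh U) cweight U y.

Definition expansive_set (U : {set X}) : Prop :=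
  weight U < nbh_cweight U \/
  (nbh_cweight U = weight U /\
   forall x y, x \notin U -> y \in nbh U -> (x, y) \in edges G ->
     cweight U y < wY G y).

Definition expansive : Prop := forall U : {set X}, expansive_set U.

End Defs.

(* Main.v *)
(* Subtracting a small [e] from every edge reduces a nowhere-zero flow to a
   nonnegative one; expansiveness makes the cut condition
   [a(U) <= \sum_y min (b y) (c(U, y))] survive this for all small [e]: if [U]
   attains equality, both sides drop by [e] times the number of edges leaving
   [U]. The cut condition suffices for a nonnegative flow by induction on the
   number of edges with nonzero capacity. The value [t] on one edge [(x0, y0)]
   must satisfy a lower bound for each cut containing [x0] and an upper bound
   for each cut avoiding [x0]; submodularity of the right-hand side makes these
   bounds compatible. *)

Require Import Defs.
From HB Require Import structures.
From mathcomp Require Import all_boot all_order all_algebra.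
From mathcomp Require Import lra.

Set Implicit Arguments.
Unset Strict Implicit.
Unset Printing Implicit Defensive.

Import Order.TTheory GRing.Theory Num.Theory.
Local Open Scope ring_scope.

Lemma sum_delta (R : nmodType) (X : finType) (P : pred X) (x0 : X) (t : R) :
  \sum_(x | P x) (if x == x0 then t else 0) = if P x0 then t else 0.
Proof.
rewrite -big_mkcondr /=; case: ifPn => Px0.
  by rewrite (big_pred1 x0) // => x /=; case: eqP => [->|]; rewrite ?Px0 ?andbF.
by rewrite big_pred0 // => x; case: eqP => [->|]; rewrite ?(negPf Px0) ?andbF.
Qed.

(** * Nonnegative flows from the cut condition *)

Section Feasibility.
Variables (R : realFieldType) (X Y : finType).
Implicit Types (a : X -> R) (b : Y -> R) (c f : X -> Y -> R) (U A B : {set X}).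

(** The max-flow min-cut inequality: once [U] is on the source side, each [y] goes to the cheaper
    side, cutting either its weight [b y] or its edges from [U]. *)
Definition cut_condition a b c :=
  forall U, \sum_(x in U) a x <= \sum_y Num.min (b y) (\sum_(x in U) c x y).

(** Concavity of the minimum with [b]: [i] and [s] enclose [p] and [q] and have the same sum. *)
Lemma min_submod (b p q s i : R) : s + i = p + q -> i <= p -> i <= q ->
  Num.min b s + Num.min b i <= Num.min b p + Num.min b q.
Proof. move=> h1 h2 h3.
by case: (leP b s); case: (leP b p); case: (leP b q); case: (leP b i); lra. Qed.

Lemma sum_setUI a A B :
  \sum_(x in A :|: B) a x + \sum_(x in A :&: B) a x =
  \sum_(x in A) a x + \sum_(x in B) a x.
Proof.
rewrite ![\sum_(x in _) a x]big_mkcond -!big_split /=; apply: eq_bigr => x _.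
by rewrite !inE; case: (x \in A); case: (x \in B); rewrite /= ?addr0 ?add0r.
Qed.

Lemma ler_sum_subset a A B : (forall x, 0 <= a x) -> A \subset B ->
  \sum_(x in A) a x <= \sum_(x in B) a x.
Proof.
move=> a_ge0 /subsetP sAB.
rewrite ![\sum_(x in _) a x]big_mkcond /=; apply: ler_sum => x _.
by case: ifPn => [/sAB ->//|_]; case: ifP.
Qed.

Lemma ler_sum_setT a A : (forall x, 0 <= a x) ->
  \sum_(x in A) a x <= \sum_x a x.
Proof.
by move=> a_ge0; rewrite big_mkcond /=; apply: ler_sum => x _; case: ifP.
Qed.

Lemma cut_condition_step a b c x0 y0 :
    (forall x y, 0 <= c x y) -> cut_condition a b c ->
  exists2 t, 0 <= t <= c x0 y0 &
    cut_condition (fun x => a x - (if x == x0 then t else 0))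
                  (fun y => b y - (if y == y0 then t else 0))
                  (fun x y => if (x == x0) && (y == y0) then 0 else c x y).
Proof.
move=> c_ge0 cut.
pose S U := \sum_(y | y != y0) Num.min (b y) (\sum_(x in U) c x y).
pose C U := \sum_(x in U) c x y0.
pose a_ U := \sum_(x in U) a x.
(* Only the summand at [y0] will change, so its minimum is split into two linear bounds. *)
have cutS U : a_ U - S U <= b y0 /\ a_ U - S U <= C U.
  by move: (cut U); rewrite (bigD1 y0) //= -lerBlDr le_min => /andP[].
have C_rem U : x0 \in U -> C (U :\ x0) = C U - c x0 y0.
  by move=> xU; rewrite /C [in RHS](big_setD1 x0) //= [RHS]addrC addKr.
have S_submod A B : S (A :|: B) + S (A :&: B) <= S A + S B.
  rewrite /S -!big_split /=; apply: ler_sum => y _.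
  apply: min_submod; first exact: sum_setUI.
    by apply: ler_sum_subset; rewrite ?subsetIl.
  by apply: ler_sum_subset; rewrite ?subsetIr.
(* For [A] containing [x0], both [a_ A] and [b y0] drop by [t], while [C A] loses [c x0 y0]. So only
   the capacity bound constrains [t], from below by [lo A]. *)
pose lo A := a_ A - S A - C A + c x0 y0.
pose t := \big[Num.max/0]_(A : {set X} | x0 \in A) lo A.
have lo_t A : x0 \in A -> lo A <= t by move=> xA; apply: le_bigmax_cond.
have t_ge0 : 0 <= t by apply: bigmax_ge_id.
(* For [B] avoiding [x0] only [b y0] drops, which bounds [t] from above. This exceeds [lo A]: add
   the weight bound for [A :|: B] to the capacity bound for [A :&: B], which misses [x0]. *)
have t_le B : x0 \notin B -> t <= b y0 - (a_ B - S B).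
  move=> xB; apply/bigmax_leP; split=> [|A xA]; first by have [] := cutS B; lra.
  have C_AB : C (A :&: B) <= C A - c x0 y0.
    rewrite -C_rem //; apply: ler_sum_subset => //.
    by rewrite subsetD1 subsetIl inE (negPf xB) andbF.
  have := sum_setUI a A B; rewrite -/(a_ _) -/(a_ _) -/(a_ A) -/(a_ B).
  have [] := cutS (A :|: B); have [] := cutS (A :&: B).
  by have := S_submod A B; rewrite /lo; lra.
have t_c : t <= c x0 y0.
  by apply/bigmax_leP; split=> // A _; have [] := cutS A; rewrite /lo; lra.
exists t => [|U]; first by rewrite t_ge0.
rewrite sumrB sum_delta (bigD1 y0) //= eqxx -/(a_ U).
have -> : \sum_(y | y != y0) Num.min (b y - (if y == y0 then t else 0))
    (\sum_(x in U) if (x == x0) && (y == y0) then 0 else c x y) = S U.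
  apply: eq_bigr => y /negPf ->; rewrite subr0; congr Num.min.
  by apply: eq_bigr => x _; rewrite andbF.
have -> : \sum_(x in U) (if (x == x0) && true then 0 else c x y0) =
          C (U :\ x0).
  rewrite /C [LHS]big_mkcond [RHS]big_mkcond; apply: eq_bigr => x _.
  by rewrite !inE andbT; case: eqP => //=; case: ifP.
rewrite -lerBlDr le_min; have [hb hC] := cutS U; case: ifPn => xU.
  rewrite C_rem //; have := lo_t U xU; rewrite /lo => ?.
  by apply/andP; split; lra.
have -> : U :\ x0 = U by apply/setDidPl; rewrite disjoint_sym disjoints1.
by have := t_le U xU => ?; apply/andP; split; lra.
Qed.

Lemma cut_condition_feasible a b c :
    (forall x y, 0 <= c x y) -> cut_condition a b c ->
    \sum_x a x = \sum_y b y ->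
  exists f, [/\ forall x y, 0 <= f x y <= c x y,
    forall x, \sum_y f x y = a x & forall y, \sum_x f x y = b y].
Proof.
have [n] := ubnP #|[set p | c p.1 p.2 != 0]|.
elim: n a b c => // n IHn a b c; rewrite ltnS => le_n c_ge0 cut bal.
have [/existsP[[x0 y0] /= c0]|/existsPn c_eq0] :=
    boolP [exists p, c p.1 p.2 != 0]; last first.
  (* With all capacities zero, the empty set gives [b >= 0] and singletons give [a <= 0]; equal
     totals then force both to vanish. *)
  have c0 x y : c x y = 0 by move: (c_eq0 (x, y)); rewrite negbK => /eqP.
  have b_ge0 y : 0 <= b y.
    have min_le0 z : Num.min (b z) 0 <= 0 by rewrite ge_min lexx orbT.
    have := cut set0; rewrite big_set0; under eq_bigr do rewrite big_set0.
    rewrite (bigD1 y) //= => cut0.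
    have : \sum_(z | z != y) Num.min (b z) 0 <= 0 by apply: sumr_le0.
    move=> rest; have : 0 <= Num.min (b y) 0 by lra.
    by rewrite le_min => /andP[].
  have a_le0 x : a x <= 0.
    rewrite -[a x](big_set1 +%R x) (le_trans (cut _)) //.
    by apply: sumr_le0 => y _; rewrite big_set1 c0 ge_min lexx orbT.
  have sum_b : \sum_y b y = 0.
    by apply/le_anti; rewrite sumr_ge0 // andbT -bal sumr_le0.
  have b0 y : b y = 0.
    exact: psumr_eq0P (fun y _ => b_ge0 y) sum_b y isT.
  have a0 x : a x = 0.
    apply/oppr_inj; rewrite oppr0.
    apply: (psumr_eq0P (P := xpredT) (F := fun x => - a x)) => // [z _|].
      by rewrite oppr_ge0.
    by rewrite sumrN bal sum_b oppr0.
  exists (fun _ _ => 0); split=> [x y|x|y]; first by rewrite c0 lexx.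
    by rewrite big1 ?a0.
  by rewrite big1 ?b0.
have [t /andP[t_ge0 t_le] cut'] := cut_condition_step x0 y0 c_ge0 cut.
set a' := fun x => _ in cut'; set b' := fun y => _ in cut'.
set c' := fun x y => _ in cut'.
have c'_ge0 x y : 0 <= c' x y by rewrite /c'; case: ifP.
have lt_n : (#|[set p | c' p.1 p.2 != 0%R]| < n)%N.
  apply: leq_trans le_n; apply: proper_card; apply/properP; split.
    by apply/subsetP=> -[x y]; rewrite !inE /c' /=; case: ifP; rewrite ?eqxx.
  by exists (x0, y0); rewrite !inE /c' /= ?eqxx.
have bal' : \sum_x a' x = \sum_y b' y by rewrite !sumrB !sum_delta bal.
have [f [f_bd fX fY]] := IHn a' b' c' lt_n c'_ge0 cut' bal'.
(* Since [c'] vanishes at [(x0, y0)], so does [f], and the new value there is exactly [t]. *)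
exists (fun x y => f x y + (if (x == x0) && (y == y0) then t else 0)).
split=> [x y|x|y].
- have := f_bd x y; rewrite /c'; case: ifP => [/andP[/eqP -> /eqP ->]|_].
    by move=> ?; apply/andP; split; lra.
  by rewrite addr0.
- rewrite big_split /= fX /a'; case: (x == x0) => /=.
    by rewrite sum_delta subrK.
  by rewrite big1 // subr0 addr0.
- rewrite big_split /= fY /b'; case: (y == y0) => /=.
    by under [X in _ + X]eq_bigr do rewrite andbT; rewrite sum_delta subrK.
  by rewrite big1 ?subr0 ?addr0 // => x _; rewrite andbF.
Qed.

End Feasibility.

(** * Properties of all sufficiently small positive numbers *)

Section ForSmall.
Variable R : realFieldType.

(** The bound [e <= d] is not strict, so that [d] itself can serve as the perturbation. *)
Definition for_small (P : R -> Prop) :=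
  exists2 d, 0 < d & forall e, 0 < e <= d -> P e.

Lemma for_small_and P Q :
  for_small P -> for_small Q -> for_small (fun e => P e /\ Q e).
Proof.
move=> [d d_gt0 hP] [d' d'_gt0 hQ]; exists (Num.min d d').
  by rewrite lt_min d_gt0.
by move=> e; rewrite le_min => /and3P[e0 ed ed']; split;
  [apply: hP | apply: hQ]; rewrite e0.
Qed.

Lemma for_small_forall (I : finType) (P : I -> R -> Prop) :
  (forall i, for_small (P i)) -> for_small (fun e => forall i, P i e).
Proof.
move=> hP.
have: for_small (fun e => forall i, i \in enum I -> P i e).
  elim: (enum I) => [|i s [d d_gt0 hs]]; first by exists 1.
  have [d' d'_gt0 h] := for_small_and (hP i) (ex_intro2 _ _ d d_gt0 hs).
  exists d' => // e /h[Pi Ps] j; rewrite inE => /predU1P[->//|]; exact: Ps.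
by move=> [d d0 h]; exists d => // e /h he i; apply: he; rewrite mem_enum.
Qed.

Lemma for_small_mulr_le (k m : R) : 0 < m -> for_small (fun e => e * k <= m).
Proof.
move=> m_gt0; have [k_le0|k_gt0] := leP k 0.
  exists 1 => // e /andP[e0 _]; apply: le_trans (ltW m_gt0).
  by rewrite pmulr_rle0.
by exists (m / k) => [|e /andP[_]]; rewrite ?divr_gt0 // ler_pdivlMr.
Qed.

End ForSmall.

(** * Nowhere-zero flows and expansiveness *)

Section Graph.
Variables (R : realFieldType) (X Y : finType) (G : bigraph R X Y).

Definition edge_ind (x : X) (y : Y) : R := ((x, y) \in edges G)%:R.

Definition deg_in (U : {set X}) (y : Y) : R := \sum_(x in U) edge_ind x y.

Definition deg (y : Y) : R := \sum_x edge_ind x y.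

Lemma deg_in_le (U : {set X}) y : deg_in U y <= deg y.
Proof. by apply: ler_sum_setT => x; rewrite ler0n. Qed.

Lemma sum_edges1 (phi : X * Y -> R) x :
  \sum_(e in edges G | e.1 == x) phi e =
  \sum_y (if (x, y) \in edges G then phi (x, y) else 0).
Proof.
rewrite big_mkcondl /=.
rewrite (eq_bigl (fun e : X * Y => (e.1 == x) && xpredT e.2)); last first.
  by move=> e; rewrite andbT.
pose F i j := if (i, j) \in edges G then phi (i, j) else 0.
rewrite (eq_bigr (fun e => F e.1 e.2)); last by case.
by rewrite -(pair_big (pred1 x) xpredT F) /= big_pred1_eq.
Qed.

Lemma sum_edges2 (phi : X * Y -> R) y :
  \sum_(e in edges G | e.2 == y) phi e =
  \sum_x (if (x, y) \in edges G then phi (x, y) else 0).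
Proof.
rewrite big_mkcondl /=.
pose F i j := if (i, j) \in edges G then phi (i, j) else 0.
rewrite (eq_bigr (fun e => F e.1 e.2)); last by case.
rewrite -(pair_big xpredT (pred1 y) F) /=.
by apply: eq_bigr => x _; rewrite big_pred1_eq.
Qed.

Lemma notin_nbh (U : {set X}) x y :
  y \notin nbh G U -> x \in U -> ((x, y) \in edges G) = false.
Proof.
move=> yN xU; apply: contraNF yN => xy; rewrite inE; apply/existsP.
by exists x; rewrite xU.
Qed.

Lemma cap_notin_nbh (U : {set X}) y :
  y \notin nbh G U -> \sum_(x in U) cap G x y = 0.
Proof.
by move=> yN; rewrite big1 // => x xU; rewrite /cap (notin_nbh yN xU).
Qed.

(** All flow leaving [U] enters [nbh G U], and each [y] receives from [U] at most its weight and at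
    most the capacity from [U]. *)
Lemma has_full_nz_flow_expansive : has_full_nz_flow G -> expansive G.
Proof.
move=> [phi [phi_bd phiX phiY]] U.
pose f x y := if (x, y) \in edges G then phi (x, y) else 0.
have f_ge0 x y : 0 <= f x y.
  by rewrite /f; case: ifP => // /phi_bd /andP[/ltW].
have weightE : weight G U = \sum_(y in nbh G U) \sum_(x in U) f x y.
  rewrite exchange_big; apply: eq_bigr => x xU; rewrite -phiX sum_edges1.
  rewrite [RHS]big_mkcond; apply: eq_bigr => y _.
  by case: (boolP (y \in _)) => // yN; rewrite (notin_nbh yN xU).
have f_le y : \sum_(x in U) f x y <= cweight G U y.
  rewrite le_min -phiY sum_edges2; apply/andP; split.
    exact: ler_sum_setT.
  by apply: ler_sum => x _; rewrite /f /cap; case: ifP => // /phi_bd /andP[].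
have : weight G U <= nbh_cweight G U by rewrite weightE; apply: ler_sum.
rewrite le_eqVlt => /orP[/eqP eqU|]; last by left.
right; split=> // x y xU yN xy.
(* Equality of the sums forces equality in every termwise bound. *)
have /eqP eq_y : \sum_(x in U) f x y == cweight G U y.
  have := leif_sum (fun (y : Y) (_ : y \in nbh G U) => leif_eq (f_le y)).
  rewrite -weightE -/(nbh_cweight G U) eqU => -[_]; rewrite eqxx.
  by move=> /esym/forall_inP; apply.
rewrite -eq_y -phiY sum_edges2.
(* The edge from [x] outside [U] carries positive flow, so [U] alone does not fill [y]. *)
apply: (@lt_le_trans _ _ (\sum_(z in x |: U) f z y)).
  rewrite big_setU1 //= ltrDr /f xy.
  by have /andP[] := phi_bd _ xy.
exact: ler_sum_setT.
Qed.

Lemma expansive_cut_condition : (forall y, 0 < wY G y) -> expansive G ->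
  for_small (fun e => cut_condition
    (fun x => wX G x - e * \sum_y edge_ind x y)
    (fun y => wY G y - e * deg y)
    (fun x y => cap G x y - e * edge_ind x y)).
Proof.
move=> wY_gt0 exG; apply: for_small_forall => U.
pose C y := \sum_(x in U) cap G x y.
(* Outside the neighbourhood the minimum is 0 because weights are positive, so the sum may run over
   all [y]. *)
have nbhE : nbh_cweight G U = \sum_y Num.min (wY G y) (C y).
  rewrite /nbh_cweight big_mkcond; apply: eq_bigr => y _.
  case: ifPn => // yN; rewrite /C cap_notin_nbh //.
  by apply/esym/min_idPr/ltW.
have lhsE e : \sum_(x in U) (wX G x - e * \sum_y edge_ind x y) =
    weight G U - e * \sum_y deg_in U y.
  by rewrite sumrB -mulr_sumr exchange_big.
have rhsE e y : \sum_(x in U) (cap G x y - e * edge_ind x y) =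
    C y - e * deg_in U y.
  by rewrite sumrB -mulr_sumr.
have [lt_U|[eq_U sat_U]] := exG U.
  (* Strict case: each minimum drops by at most [e * deg y], and the gap absorbs the excess over the
     drop on the left. *)
  have gap : 0 < nbh_cweight G U - weight G U by rewrite subr_gt0.
  have [d d_gt0 small] := for_small_mulr_le
    (\sum_y deg y - \sum_y deg_in U y) gap.
  exists d => // e e_d; rewrite lhsE; under [leRHS]eq_bigr do rewrite rhsE.
  have e_gt0 : 0 < e by case/andP: e_d.
  have : \sum_y (Num.min (wY G y) (C y) - e * deg y) <=
      \sum_y Num.min (wY G y - e * deg y) (C y - e * deg_in U y).
    apply: ler_sum => y _; rewrite le_min !lerD2r ge_min lexx /=.
    apply: lerB; first by rewrite ge_min lexx orbT.
    by rewrite ler_pM2l ?deg_in_le.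
  by rewrite sumrB -nbhE -mulr_sumr; have := small e e_d; rewrite mulrBr; lra.
(* Tight case: each minimum may drop by at most [e * deg_in U y]. If [wY G y <= C y], expansiveness
   forbids edges to [y] from outside [U], so both arguments shift equally; otherwise the slack
   [wY G y - C y] suffices. *)
have : for_small (fun e => forall y, Num.min (wY G y) (C y) - e * deg_in U y <=
    Num.min (wY G y - e * deg y) (C y - e * deg_in U y)).
  apply: for_small_forall => y; have [le_y|lt_y] := leP (wY G y) (C y).
    have degE : deg_in U y = deg y.
      rewrite /deg_in [LHS]big_mkcond; apply: eq_bigr => x _.
      case: ifPn => // xU; rewrite /edge_ind; case: (boolP (_ \in _)) => // xy.
      have yN : y \in nbh G U.
        apply: contraLR le_y => yN.
        by rewrite /C cap_notin_nbh // -ltNge.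
      have := sat_U x y xU yN xy.
      by rewrite /cweight -/(C y) (min_idPl le_y) ltxx.
    by exists 1 => // e _; rewrite degE le_min lexx lerD2r.
  have gap : 0 < wY G y - C y by rewrite subr_gt0.
  have [d d_gt0 small] := for_small_mulr_le (deg y - deg_in U y) gap.
  exists d => // e /small; rewrite le_min lexx andbT mulrBr; lra.
move=> [d d_gt0 small]; exists d => // e /small le_e.
rewrite lhsE; under [leRHS]eq_bigr do rewrite rhsE.
by rewrite -eq_U nbhE mulr_sumr -sumrB; apply: ler_sum.
Qed.

Lemma expansive_has_full_nz_flow :
    (forall y, 0 < wY G y) -> (forall e, e \in edges G -> 0 < ecap G e) ->
    \sum_x wX G x = \sum_y wY G y ->
  expansive G -> has_full_nz_flow G.
Proof.
move=> wY_gt0 ecap_gt0 bal exG.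
have cap_small : for_small (fun e => forall p, p \in edges G -> e <= ecap G p).
  apply: for_small_forall => p; case: (boolP (p \in _)) => [pG|_].
    by exists (ecap G p) => [|e /andP[]//]; apply: ecap_gt0.
  by exists 1.
have [d d_gt0 small] := for_small_and cap_small
  (expansive_cut_condition wY_gt0 exG).
have {small}[|cap_d cut] := small d; first by rewrite d_gt0 /=.
have [||f [f_bd fX fY]] := cut_condition_feasible _ cut.
- move=> x y; rewrite /cap /edge_ind; case: ifP => [/cap_d|_].
    by rewrite mulr1 subr_ge0.
  by rewrite mulr0 subr0.
(* Both totals lose [d] times the number of edges. *)
- by rewrite !sumrB bal -!mulr_sumr exchange_big.
(* Off the edges the reduced capacity is 0, so [f] vanishes there and restoring [d] on edges alone
   recovers the node sums. *)
have fE x y : (if (x, y) \in edges G then f x y + d else 0) =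
    f x y + d * edge_ind x y.
  have := f_bd x y; rewrite /cap /edge_ind.
  case: ifP => _; first by rewrite mulr1.
  by rewrite mulr0 subr0 addr0 => /le_anti.
exists (fun e => f e.1 e.2 + d); split=> [[x y] xy|x|y].
- have := f_bd x y; rewrite /cap /edge_ind xy mulr1 /=.
  by move=> /andP[f0 f1]; apply/andP; split; lra.
- rewrite sum_edges1 /=; under eq_bigr do rewrite fE.
  by rewrite big_split /= fX -mulr_sumr subrK.
- rewrite sum_edges2 /=; under eq_bigr do rewrite fE.
  by rewrite big_split /= fY -mulr_sumr subrK.
Qed.

End Graph.

Theorem theorem8 (R : realFieldType) (X Y : finType) (G : bigraph R X Y)
    (wX_gt0 : forall x : X, 0 < wX G x)
    (wY_gt0 : forall y : Y, 0 < wY G y)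
    (ecap_gt0 : forall e : X * Y, e \in edges G -> 0 < ecap G e)
    (balanced : \sum_(x : X) wX G x = \sum_(y : Y) wY G y) :
  has_full_nz_flow G <-> expansive G.
Proof.
split; first exact: has_full_nz_flow_expansive.
exact: expansive_has_full_nz_flow.
Qed.
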